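(* Let $X = A\cup B\cup\{1\}$ be a finite set, where $A$, $B$ and $\{1\}$ are pairwise disjoint and $A\neq\emptyset$, $B\neq\emptyset$. Let $\mathcal{S}$ and $\mathcal{S}'$ be opposite precells relative to $X$, and let $\mathcal{S}_A$ (a precell relative to $A\cup\{1\}$) and $\mathcal{S}_B$ (a precell relative to $B\cup\{1\}$) be the precells induced by $\mathcal{S}$, as defined in the context. Then, in $\mathcal{A}(A\cup\{1\})\otimes\mathcal{A}(B\cup\{1\})$, $$\mathbf{Fac}(\mathcal{U}_{\mathcal{S}}) = \mathcal{U}_{\mathcal{S}_A}\otimes\mathcal{U}_{\mathcal{S}_B}.$$
   Context: For a finite set $W$ with $|W|\ge 2$: - $\mathcal{P}_*(W)=\{J\subset W : J\neq\emptyset,\ J\neq W\}$ is the set of proper subsets of $W$. - A proper sequence in $\mathcal{P}(W)$ is a finite (ordered) sequence $\{J_1,\dots,J_\nu\}$ of non-empty, pairwise disjoint subsets of $W$ with union $W$. Proper sequences are multiplied by $$\{A_1,\dots,A_n\}\{B_1,\dots,B_m\}=\{A_1\cap B_1,\dots,A_n\cap B_1,\ \dots,\ A_1\cap B_m,\dots,A_n\cap B_m\}\ \mathrm{mod}\ \emptyset,$$ where ''mod $\emptyset$'' means that every occurrence of the empty set is omitted. $\mathcal{A}(W)$ is the complex vector space with basis the proper sequences in $\mathcal{P}(W)$, with the bilinear extension of this multiplication; it is an associative algebra with unit $\{W\}$. - A paracell relative to $W$ is a non-empty subset $\mathcal{S}$ of $\mathcal{P}_*(W)$ such that $I,J\in\mathcal{S}$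 implies $I\cap J\in\mathcal{S}$ or $I\cup J\in\mathcal{S}$. Its opposite is the paracell $\mathcal{S}'=\{J\subset W: W\setminus J\in\mathcal{S}\}$; one has $\mathcal{S}\cap\mathcal{S}'=\emptyset$. A precell relative to $W$ is a paracell $\mathcal{S}$ with $\mathcal{S}\cup\mathcal{S}'=\mathcal{P}_*(W)$; then $\mathcal{S}'$ is also a precell. - For a paracell $\mathcal{S}$ relative to $W$ with opposite $\mathcal{S}'$, $\mathcal{M}_\nu(\mathcal{S}')$ denotes the set of proper sequences $\{J_1,\dots,J_\nu\}$ in $\mathcal{P}(W)$ such that $J_1\cup\dots\cup J_r\in\mathcal{S}'$ for every $r$ with $1\le r<\nu$ (no condition if $\nu=1$), and $$\mathcal{U}_{\mathcal{S}}=\sum_{\nu=1}^{|W|}\ \sum_{\{J_1,\dots,J_\nu\}\in\mathcal{M}_\nu(\mathcal{S}')}(-1)^{\nu-1}\{J_1,\dots,J_\nu\}\in\mathcal{A}(W).$$ Induced precells: for opposite precells $\mathcal{S},\mathcal{S}'$ relative to $X=A\cup B\cup\{1\}$, $$\mathcal{S}_A=\{J\in\mathcal{P}_*(A\cup\{1\}): J\subset A,\ J\in\mathcal{S}\}\cup\{J\in\mathcal{P}_*(A\cup\{1\}): 1\in J,\ A\setminus J\in\mathcal{S}'\},$$ and $\mathcal{S}_B$ is defined in the same way with $B$ in place of $A$. ($\mathcal{S}_A$ and $\mathcal{S}_B$ are precells relative to $A\cup\{1\}$ and $B\cup\{1\}$ respectively.) The map $\mathbf{Fac}:\mathcal{A}(X)\to\mathcal{A}(A\cup\{1\})\otimes\mathcal{A}(B\cup\{1\})$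 is the linear map defined on a proper sequence $c=\{J_1,\dots,J_\nu\}$ by $\mathbf{Fac}(c)=c_A\otimes c_B$, where $c_A=\{J_1\cap(A\cup\{1\}),\dots,J_\nu\cap(A\cup\{1\})\}\ \mathrm{mod}\ \emptyset$ and $c_B=\{J_1\cap(B\cup\{1\}),\dots,J_\nu\cap(B\cup\{1\})\}\ \mathrm{mod}\ \emptyset$. *)

(* Defs.v *)
From HB Require Import structures.
From mathcomp Require Import all_boot all_order all_algebra.
From mathcomp Require Import reals.
From mathcomp Require Export complex.

Set Implicit Arguments.
Unset Strict Implicit.
Unset Printing Implicit Defensive.

Import GRing.Theory.
Local Open Scope ring_scope.

(* Finite sets W are represented as subsets W : {set T} of an ambient finite
   type T, so that a set and its subsets live in the same type. *)

Section Cells.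
Variable T : finType.
Implicit Types (W J : {set T}) (S : {set {set T}}).

Definition proper_subsets W : {set {set T}} :=
  [set J : {set T} | [&& J \subset W, J != set0 & J != W]].

(* The clause S != set0 forces #|W| >= 2. *)
Definition paracell W S : bool :=
  [&& S \subset proper_subsets W, S != set0 &
      [forall I in S, forall J in S, (I :&: J \in S) || (I :|: J \in S)]].

Definition opposite W S : {set {set T}} :=
  [set J : {set T} | (J \subset W) && (W :\: J \in S)].

Definition precell W S : bool :=
  paracell W S && (S :|: opposite W S == proper_subsets W).

Definition is_proper_seq W (c : seq {set T}) : bool :=
  [&& all (fun J => J != set0) c,
      pairwise (fun I J : {set T} => [disjoint I & J]) c &
      \bigcup_(J <- c) J == W].

End Cells.

Record proper_seq (T : finType) (W : {set T}) := ProperSeq {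
  ps_seq :> seq {set T};
  ps_proper : is_proper_seq W ps_seq }.

HB.instance Definition _ T W := [isSub for @ps_seq T W].
HB.instance Definition _ T (W : {set T}) :=
  [Countable of proper_seq W by <:].

Section ProperSeqFinite.
Variables (T : finType) (W : {set T}).

Lemma uniq_proper_seq (c : proper_seq W) : uniq c.
Proof.
have /and3P[+ + _] := ps_proper c; move: (ps_seq c) => s.
elim: s => //= J s IHs /andP[Jn0 sn0] /andP[Js ds].
rewrite {}IHs // andbT; apply: contraNN Jn0 => sJ.
by have := allP Js _ sJ; rewrite /= -setI_eq0 setIid.
Qed.

Lemma size_proper_seq (c : proper_seq W) : (size c <= #|{set T}|)%N.
Proof. by rewrite -(card_uniqP (uniq_proper_seq c)) max_card. Qed.

Definition bseq_of_proper_seq (c : proper_seq W) :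
  #|{set T}|.-bseq {set T} := Bseq (size_proper_seq c).

Definition proper_seq_of_bseq (s : #|{set T}|.-bseq {set T}) :
  option (proper_seq W) := insub (bseqval s).

Lemma bseq_of_proper_seqK : pcancel bseq_of_proper_seq proper_seq_of_bseq.
Proof. by move=> c; rewrite /proper_seq_of_bseq /= valK. Qed.

HB.instance Definition _ : isFinite (proper_seq W) :=
  PCanIsFinite bseq_of_proper_seqK.

End ProperSeqFinite.

(* The K-vector space with basis I is {ffun I -> K^o}. *)
Definition free_basis (K : fieldType) (I : finType) (i : I) :
  {ffun I -> K^o} := [ffun j => (j == i)%:R].

Lemma free_basis_sum (K : fieldType) (I : finType) (u : {ffun I -> K^o}) :
  u = \sum_i u i *: free_basis K i.
Proof.
apply/ffunP => j; rewrite sum_ffunE (bigD1 j) //= big1 => [|i ij].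
  by rewrite !ffunE eqxx addr0 [RHS]mulr1.
by rewrite !ffunE eq_sym (negPf ij) scaler0.
Qed.

(* The tensor product of the spaces with bases I and J is modelled as the
   space with basis I * J; see tensor_universal. *)
Definition tensor (K : fieldType) (I J : finType)
  (u : {ffun I -> K^o}) (v : {ffun J -> K^o}) : {ffun I * J -> K^o} :=
  [ffun p => u p.1 * v p.2].

Section Tensor.
Variables (K : fieldType) (I J : finType).

Lemma tensor_basis (i : I) (j : J) :
  tensor (free_basis K i) (free_basis K j) = free_basis K (i, j).
Proof.
by apply/ffunP => -[k l]; rewrite !ffunE xpair_eqE -natrM mulnb.
Qed.

Lemma tensor_bilinear : bilinear_for *:%R *:%R (@tensor K I J).
Proof.
split=> [v a u u'|u a v v']; apply/ffunP => p; rewrite !ffunE /=.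
  by rewrite mulrDl -[(a *: _ : K^o) * _]mulrA.
by rewrite mulrDr [u p.1 * _]mulrCA.
Qed.

HB.instance Definition _ :=
  @bilinear_isBilinear.Build K {ffun I -> K^o} {ffun J -> K^o}
    {ffun I * J -> K^o} *:%R *:%R (@tensor K I J) tensor_bilinear.

Lemma tensor_universal (V : lmodType K)
    (f : {bilinear {ffun I -> K^o} -> {ffun J -> K^o} -> V}) :
  exists g : {linear {ffun I * J -> K^o} -> V},
    (forall u v, g (tensor u v) = f u v) /\
    (forall g' : {linear {ffun I * J -> K^o} -> V},
       (forall u v, g' (tensor u v) = f u v) -> g' =1 g).
Proof.
pose g (w : {ffun I * J -> K^o}) :=
  \sum_p w p *: f (free_basis K p.1) (free_basis K p.2).
have g_lin : linear g.
  move=> a w w'; rewrite scaler_sumr -big_split; apply: eq_bigr => p _ /=.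
  by rewrite !ffunE scalerDl scalerA.
pose gL : {linear {ffun I * J -> K^o} -> V} :=
  HB.pack g (@GRing.isLinear.Build K _ V *:%R g g_lin).
exists gL; split=> [u v|g' g'f w].
  rewrite [in RHS](free_basis_sum u) [in RHS](free_basis_sum v) linear_sumlz.
  transitivity (\sum_i \sum_j
      tensor u v (i, j) *: f (free_basis K i) (free_basis K j)).
    by rewrite pair_bigA; apply: eq_bigr => -[].
  apply: eq_bigr => i _; rewrite linear_sumr; apply: eq_bigr => j _.
  by rewrite linearZr_LR linearZl_LR ffunE scalerA mulrC.
rewrite [in LHS](free_basis_sum w) linear_sum; apply: eq_bigr => -[i j] _.
by rewrite linearZ -tensor_basis g'f.
Qed.
End Tensor.

Section Restriction.
Variable T : finType.
Implicit Types (W X : {set T}).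

Definition restrict_seq W (c : seq {set T}) : seq {set T} :=
  [seq J <- [seq J :&: W | J : {set T} <- c] | J != set0].

Lemma restrict_seq_proper X W (c : proper_seq X) :
  W \subset X -> is_proper_seq W (restrict_seq W c).
Proof.
move=> WX; have /and3P[_ dc /eqP cX] := ps_proper c; apply/and3P; split.
- exact: filter_all.
- apply/pairwise_filter; rewrite pairwise_map.
  apply: sub_pairwise dc => I J; rewrite /= -!setI_eq0 => /eqP IJ0.
  by rewrite setIACA IJ0 set0I.
- rewrite big_filter big_mkcond big_map.
  rewrite (eq_bigr (fun J => J :&: W)) => [|J _]; last first.
    by case: eqP => //= ->.
  by rewrite -big_distrl /= cX (setIidPr WX).
Qed.

Definition restrict X W (WX : W \subset X) (c : proper_seq X) :
  proper_seq W := ProperSeq (restrict_seq_proper c WX).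

End Restriction.

(* The underlying vector space of A(W); the product of A(W) is not needed. *)
Definition psAlg (R : realType) (T : finType) (W : {set T}) :=
  {ffun proper_seq W -> R[i]^o}.

Definition psAlg_tensor (R : realType) (T : finType) (V W : {set T}) :=
  {ffun proper_seq V * proper_seq W -> R[i]^o}.

Section CellElements.
Variables (R : realType) (T : finType).
Implicit Types (W : {set T}) (S : {set {set T}}).

Definition seqs_through W S (nu : nat) : {set proper_seq W} :=
  [set c : proper_seq W | (size c == nu) &&
     [forall r : 'I_nu, (1 <= r)%N ==> (\bigcup_(J <- take r c) J \in S)]].

Definition cell_elt W S : psAlg R W :=
  \sum_(1 <= nu < #|W|.+1)
     \sum_(c in seqs_through W (opposite W S) nu)
        (-1) ^+ (nu - 1) *: free_basis R[i] c.

End CellElements.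

(* S_A, for S relative to A :|: B :|: [set o], with S' the opposite of S *)
Definition induced_cell (T : finType) (S S' : {set {set T}}) (A : {set T})
    (o : T) : {set {set T}} :=
  [set J in proper_subsets (A :|: [set o]) |
     ((J \subset A) && (J \in S)) || ((o \in J) && (A :\: J \in S'))].

Section Fac.
Variables (R : realType) (T : finType) (A B : {set T}) (o : T).

Lemma fac_subl : A :|: [set o] \subset A :|: B :|: [set o].
Proof. by rewrite setSU ?subsetUl. Qed.

Lemma fac_subr : B :|: [set o] \subset A :|: B :|: [set o].
Proof. by rewrite setSU ?subsetUr. Qed.

Definition Fac (u : psAlg R (A :|: B :|: [set o])) :
    psAlg_tensor R (A :|: [set o]) (B :|: [set o]) :=
  \sum_c u c *: tensor (free_basis R[i] (restrict fac_subl c))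
                       (free_basis R[i] (restrict fac_subr c)).

Lemma Fac_linear : linear Fac.
Proof.
move=> a u v; rewrite scaler_sumr -big_split; apply: eq_bigr => c _ /=.
by rewrite !ffunE scalerDl scalerA.
Qed.

HB.instance Definition _ :=
  GRing.isLinear.Build R[i] (psAlg R (A :|: B :|: [set o]))
    (psAlg_tensor R (A :|: [set o]) (B :|: [set o])) *:%R Fac Fac_linear.

Lemma Fac_basis (c : proper_seq (A :|: B :|: [set o])) :
  Fac (free_basis R[i] c) =
    tensor (free_basis R[i] (restrict fac_subl c))
           (free_basis R[i] (restrict fac_subr c)).
Proof.
rewrite /Fac (bigD1 c) //= big1 => [|d dc]; rewrite ffunE.
  by rewrite eqxx scale1r addr0.
by rewrite (negPf dc) scale0r.
Qed.

End Fac.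

(* Main.v *)
(* Compare coefficients at a pair (a, b) of proper sequences. Cut a and b at the
   blocks Ja, Jb containing the common point o. A sequence c restricting to a and
   b has the block Ja U Jb, preceded by a quasi-shuffle (stuffle) of the blocks
   of a and b before o and followed by one of the blocks after o. The coefficient
   of c splits accordingly: before o, the sign times the condition that all
   non-empty partial unions lie in S'; after o, by complementation, the sign times
   the condition that all non-empty unions of final blocks lie in S. Both have the
   form "sign times a condition on suffix unions" (after reversal), and the sum of
   such weights over the stuffle of a1 and b1 is the product of the weights of a1
   and b1. This follows by induction on the recursion of the stuffle product: its
   three branches have the same total union, and a disjoint union I U J with I in
   A, J in B lies in S (resp. S') if both parts do, and does not if neither does. *)
Require Import Defs.
From mathcomp Require Import all_boot all_order all_algebra reals.
From mathcomp Require Import zify ring.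

Set Implicit Arguments.
Unset Strict Implicit.
Unset Printing Implicit Defensive.

Import GRing.Theory.
Local Open Scope ring_scope.

Lemma sum_free_basisE (K : fieldType) (I : finType) (A : {set I}) (x : K) i :
  (\sum_(d in A) x *: free_basis K d) i = x * (i \in A)%:R.
Proof.
rewrite sum_ffunE; case: (boolP (i \in A)) => iA.
  rewrite (bigD1 i) //= big1 ?addr0 => [|d /andP[_ di]]; rewrite !ffunE ?eqxx //.
  by rewrite eq_sym (negPf di) scaler0.
rewrite big1 ?mulr0 // => d dA; rewrite !ffunE.
by case: eqP => [cd|_]; [rewrite cd dA in iA | rewrite scaler0].
Qed.

(** * Blocks, their unions, and proper sequences *)

Section SetSequences.
Variable T : finType.
Implicit Types (I J V W : {set T}) (a b c d : seq {set T}).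
Implicit Types (S : {set {set T}}).

(** What a piece of a proper sequence retains after a cut; tails inherit it, so inductions on the
    sequence go through. *)
Definition blocks_in W c := all (fun J => (J != set0) && (J \subset W)) c.

Lemma blocks_in_rev W c : blocks_in W (rev c) = blocks_in W c.
Proof. exact: all_rev. Qed.

Lemma blocks_in_sub V W c : V \subset W -> blocks_in V c -> blocks_in W c.
Proof.
move=> VW; apply: sub_all => J /andP[-> JV] /=; exact: subset_trans JV VW.
Qed.

Lemma bigcup_blocks_sub W c : blocks_in W c -> \bigcup_(J <- c) J \subset W.
Proof.
elim: c => [|J c IHc] /=; first by rewrite big_nil sub0set.
by move=> /andP[/andP[_ JW] /IHc cW]; rewrite big_cons subUset JW.
Qed.

Lemma bigcup_blocks_neq0 W J c : blocks_in W (J :: c) -> \bigcup_(I <- J :: c) I != set0.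
Proof. by case/andP=> /andP[J0 _] _; rewrite big_cons setU_eq0 negb_and J0. Qed.

Lemma mem_bigcup_seq J c : J \in c -> J \subset \bigcup_(I <- c) I.
Proof. by move=> Jc; rewrite (big_rem J) //= subsetUl. Qed.

Lemma proper_seq_blocks W (c : seq {set T}) : is_proper_seq W c -> blocks_in W c.
Proof.
case/and3P=> c0 _ /eqP cW; apply/allP => J Jc; rewrite (allP c0) //=.
by rewrite -cW mem_bigcup_seq.
Qed.

Lemma disjoint_bigcup_seq J c :
  [disjoint J & \bigcup_(I <- c) I] = all (fun I : {set T} => [disjoint J & I]) c.
Proof.
elim: c => [|I c IHc] /=; first by rewrite big_nil -setI_eq0 setI0 eqxx.
by rewrite big_cons -IHc -!setI_eq0 setIUr setU_eq0.
Qed.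

Lemma disjoint_bigcup_cat c d :
  pairwise (fun I J : {set T} => [disjoint I & J]) (c ++ d) ->
  [disjoint \bigcup_(I <- c) I & \bigcup_(J <- d) J].
Proof.
elim: c => [|I c IHc] /=; first by rewrite big_nil -setI_eq0 set0I.
rewrite all_cat => /andP[/andP[_ Id] /IHc cd].
by rewrite big_cons -setI_eq0 setIUl setU_eq0 !setI_eq0 disjoint_bigcup_seq Id.
Qed.

(** Disjoint non-empty blocks each use up at least one point. The bound puts every proper sequence
    in the range of the sum defining [cell_elt]. *)
Lemma leq_size_proper_seq W c : is_proper_seq W c -> (size c <= #|W|)%N.
Proof.
case/and3P=> c0 dc /eqP <-; elim: c c0 dc => //= J c IHc /andP[J0 c0] /andP[Jc dc].
move: Jc; rewrite -disjoint_bigcup_seq big_cons -leq_card_setU => /eqP ->.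
have := IHc c0 dc; rewrite -card_gt0 in J0; lia.
Qed.

(** By disjointness and covering, the final blocks fill exactly the complement of the initial
    ones. *)
Lemma mem_opposite_cut W S c d : is_proper_seq W (c ++ d) ->
  (\bigcup_(J <- c) J \in opposite W S) = (\bigcup_(J <- d) J \in S).
Proof.
case/and3P=> _ /disjoint_bigcup_cat cd /eqP; rewrite big_cat /= => <-.
by rewrite inE subsetUl setDUl setDv set0U (setDidPl _) // disjoint_sym.
Qed.

(** * Restriction of sequences to a subset *)

Lemma restrict_seq_cat W c d :
  restrict_seq W (c ++ d) = restrict_seq W c ++ restrict_seq W d.
Proof. by rewrite /restrict_seq map_cat filter_cat. Qed.

Lemma restrict_seq_rev W c : restrict_seq W (rev c) = rev (restrict_seq W c).
Proof. by rewrite /restrict_seq map_rev filter_rev. Qed.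

Lemma restrict_seq_cons W J c : restrict_seq W (J :: c) =
  if J :&: W == set0 then restrict_seq W c else J :&: W :: restrict_seq W c.
Proof. by rewrite /restrict_seq /=; case: eqP. Qed.

Lemma bigcup_restrict_seq W c :
  \bigcup_(J <- restrict_seq W c) J = (\bigcup_(J <- c) J) :&: W.
Proof.
elim: c => [|J c IHc]; first by rewrite /restrict_seq /= !big_nil set0I.
rewrite restrict_seq_cons big_cons setIUl -IHc.
by case: eqP => [->|_]; rewrite ?set0U ?big_cons.
Qed.

Lemma pairwise_disjoint_restrict W c :
  pairwise (fun I J : {set T} => [disjoint I & J]) (restrict_seq W c) =
  pairwise (fun I J : {set T} => [disjoint I :&: W & J :&: W]) c.
Proof.
elim: c => //= J c IHc; rewrite restrict_seq_cons -{}IHc.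
have all_dis I : all (fun K : {set T} => [disjoint I & K]) (restrict_seq W c) =
    all (fun K : {set T} => [disjoint I & K :&: W]) c.
  elim: c => //= K c IHc; rewrite restrict_seq_cons -{}IHc.
  by case: eqP => //= ->; rewrite -setI_eq0 setI0 eqxx.
case: eqP => [->|_] /=; last by rewrite all_dis.
by rewrite (eq_all (a2 := predT)) ?all_predT // => K; rewrite -setI_eq0 set0I eqxx.
Qed.

(** A point shared by two blocks lies in [V] or in [W], and there the two traces would meet. *)
Lemma is_proper_seq_glue V W c : blocks_in (V :|: W) c ->
  is_proper_seq V (restrict_seq V c) -> is_proper_seq W (restrict_seq W c) ->
  is_proper_seq (V :|: W) c.
Proof.
move=> cVW /and3P[_ dV /eqP uV] /and3P[_ dW /eqP uW]; apply/and3P; split.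
- by apply: sub_all cVW => J /andP[].
- move: dV dW; rewrite !pairwise_disjoint_restrict.
  elim: c cVW {uV uW} => //= J c IHc /andP[/andP[_ JVW] cVW].
  case/andP=> JV dV /andP[JW dW]; rewrite IHc // andbT.
  apply/allP => K Kc; rewrite -setI_eq0; apply/set0Pn => -[x /setIP[xJ xK]].
  case/setUP: (subsetP JVW x xJ) => [xV|xW].
    have := allP JV _ Kc; rewrite /= disjoints_subset => /subsetP/(_ x).
    by rewrite !inE xJ xK xV => /(_ isT).
  have := allP JW _ Kc; rewrite /= disjoints_subset => /subsetP/(_ x).
  by rewrite !inE xJ xK xW => /(_ isT).
- move: uV uW; rewrite !bigcup_restrict_seq => /setIidPr uV /setIidPr uW.
  by rewrite eqEsubset bigcup_blocks_sub // subUset uV uW.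
Qed.

Lemma restrict_seq_id V c : blocks_in V c -> restrict_seq V c = c.
Proof.
elim: c => //= J c IHc /andP[/andP[J0 /setIidPl JV] /IHc cV].
by rewrite restrict_seq_cons JV (negPf J0) cV.
Qed.

Lemma restrict_seq_disjoint V W c : blocks_in (W :\: V) c -> restrict_seq V c = [::].
Proof.
elim: c => //= J c IHc /andP[/andP[_ +] /IHc cV].
by rewrite subsetD restrict_seq_cons setI_eq0 => /andP[_ ->].
Qed.

(** * The stuffle product and its compatibility with restriction *)

Fixpoint stuffle a : seq {set T} -> seq (seq {set T}) :=
  match a with
  | [::] => fun b => [:: b]
  | L :: a' => fix stuffle_a b := match b with
    | [::] => [:: L :: a']
    | M :: b' => [seq L :: c | c <- stuffle a' b] ++
                 [seq M :: c | c <- stuffle_a b'] ++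
                 [seq (L :|: M) :: c | c <- stuffle a' b']
    end
  end.

Lemma stuffle_cons I a J b : stuffle (I :: a) (J :: b) =
  [seq I :: c | c <- stuffle a (J :: b)] ++
  [seq J :: c | c <- stuffle (I :: a) b] ++
  [seq (I :|: J) :: c | c <- stuffle a b].
Proof. by []. Qed.

Lemma stuffles0 a : stuffle a [::] = [:: a].
Proof. by case: a. Qed.

Lemma bigcup_stuffle a b c : c \in stuffle a b ->
  \bigcup_(J <- c) J = \bigcup_(J <- a) J :|: \bigcup_(J <- b) J.
Proof.
elim: a b c => [|I a IHa] b c; first by rewrite inE big_nil set0U => /eqP->.
elim: b c => [|J b IHb] c.
  by rewrite stuffles0 inE big_nil setU0 => /eqP->.
rewrite stuffle_cons !mem_cat => /or3P[] /mapP[d + ->].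
- by move/IHa; rewrite !big_cons => ->; rewrite setUA.
- by move/IHb; rewrite !big_cons => ->; rewrite setUCA.
- by move/IHa; rewrite !big_cons => ->; rewrite setUACA.
Qed.

Lemma mem_stuffle_consl I a b c : c \in stuffle a b -> I :: c \in stuffle (I :: a) b.
Proof.
case: b => [|J b] cab; first by rewrite !stuffles0 !inE in cab *; rewrite (eqP cab).
by rewrite stuffle_cons !mem_cat map_f.
Qed.

Lemma mem_stuffle_consr J a b c : c \in stuffle a b -> J :: c \in stuffle a (J :: b).
Proof.
case: a => [|I a] cab; first by rewrite /= !inE in cab *; rewrite (eqP cab).
by rewrite stuffle_cons !mem_cat [X in [|| _, X | _]]map_f ?orbT.
Qed.

Lemma mem_stuffle_cons2 I J a b c :
  c \in stuffle a b -> I :|: J :: c \in stuffle (I :: a) (J :: b).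
Proof.
by move=> cab; rewrite stuffle_cons !mem_cat [X in [|| _, _ | X]]map_f ?orbT.
Qed.

Section TwoGrounds.
Variables V W : {set T}.

(** Restricting to [V] erases the blocks of [b] and cuts a merged block [I :|: J] back to [I];
    symmetrically for [W]. *)
Lemma stuffle_restrict a b c :
  blocks_in (V :\: W) a -> blocks_in (W :\: V) b -> c \in stuffle a b ->
  [/\ blocks_in (V :|: W) c, restrict_seq V c = a & restrict_seq W c = b].
Proof.
elim: a b c => [|I a IHa] b c.
  move=> _ bW; rewrite inE => /eqP->.
  split; [|exact: restrict_seq_disjoint bW|].
    by apply: blocks_in_sub bW; rewrite subsetU // subsetDl orbT.
  by rewrite restrict_seq_id // (blocks_in_sub _ bW) ?subsetDl.
elim: b c => [|J b IHb] c.
  move=> aV _; rewrite inE => /eqP->.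
  split; [| |exact: restrict_seq_disjoint aV].
    by apply: blocks_in_sub aV; rewrite subsetU // subsetDl.
  by rewrite restrict_seq_id // (blocks_in_sub _ aV) ?subsetDl.
move=> aV bW; rewrite stuffle_cons !mem_cat.
have /andP[/andP[I0 IVW] aV'] := aV; have /andP[/andP[J0 JWV] bW'] := bW.
move: (IVW) (JWV); rewrite !subsetD => /andP[IV IW] /andP[JW JV].
have IVE := setIidPl IV; have JWE := setIidPl JW.
move: IW JV; rewrite -!setI_eq0 => /eqP IWE /eqP JVE.
case/or3P=> /mapP[d + ->].
- case/(IHa _ _ aV' bW) => dVW dV dW.
  by rewrite !restrict_seq_cons /= IVE IWE eqxx I0 (negPf I0) dV dW subsetU ?IV.
- case/(IHb _ aV bW') => dVW dV dW.
  by rewrite !restrict_seq_cons /= JVE JWE eqxx J0 (negPf J0) dV dW subsetU ?JW ?orbT.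
- case/(IHa _ _ aV' bW') => dVW dV dW.
  rewrite !restrict_seq_cons !setIUl /= IVE IWE JVE JWE setU0 set0U.
  by rewrite setU_eq0 (negPf I0) (negPf J0) dV dW setUSS.
Qed.

(** A block is the union of its two traces; which of them is empty selects the branch of the
    recursion. *)
Lemma restrict_stuffle c : blocks_in (V :|: W) c ->
  c \in stuffle (restrict_seq V c) (restrict_seq W c).
Proof.
elim: c => //= J c IHc /andP[/andP[J0 JVW] /IHc cS].
have JE : J = (J :&: V) :|: (J :&: W) by rewrite -setIUr (setIidPl JVW).
rewrite !restrict_seq_cons; case: eqP => JV; case: eqP => JW.
- by rewrite JE JV JW setU0 eqxx in J0.
- by rewrite {1}JE JV set0U mem_stuffle_consr.
- by rewrite {1}JE JW setU0 mem_stuffle_consl.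
- by rewrite {1}JE mem_stuffle_cons2.
Qed.

(** The branches start with [I], [J] and [I :|: J], which differ because [I] and [J] are disjoint
    and non-empty. *)
Lemma uniq_stuffle a b :
  blocks_in (V :\: W) a -> blocks_in (W :\: V) b -> uniq (stuffle a b).
Proof.
elim: a b => [|I a IHa] b //; elim: b => [|J b IHb] //.
move=> aV bW.
have /andP[/andP[I0 IVW] aV'] := aV; have /andP[/andP[J0 JWV] bW'] := bW.
have IJ0 : I :&: J = set0.
  apply/setP => x; rewrite !inE; apply/negbTE/andP => -[/(subsetP IVW) + /(subsetP JWV)].
  by rewrite !inE => /andP[/negPf-> _]; rewrite andbF.
have mapN K L s t : K != L ->
    ~~ has (mem [seq K :: c | c <- s]) [seq L :: c | c <- t].
  move=> KL; apply/hasPn => _ /mapP[c _ ->]; apply/mapP => -[d _ [LK _]].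
  by rewrite LK eqxx in KL.
have IJ : I != J by apply: contraNneq I0 => E; rewrite -IJ0 -E setIid.
have IIJ : I != I :|: J.
  apply: contraNneq J0 => E; rewrite -IJ0 eq_sym; apply/eqP/setIidPr.
  by rewrite E subsetUr.
have JIJ : J != I :|: J.
  apply: contraNneq I0 => E; rewrite -IJ0 eq_sym; apply/eqP/setIidPl.
  by rewrite E subsetUl.
rewrite stuffle_cons !cat_uniq has_cat negb_or !map_inj_uniq; try by move=> ? ? [].
by rewrite !IHa // IHb // !mapN.
Qed.

End TwoGrounds.

(** * Signed weights and their multiplicativity over the stuffle *)

Section Weight.
Variable K : comNzRingType.

(* [drop r c] runs over the non-empty suffixes of c; suffixes rather than
   prefixes, because [stuffle] branches on the first block. *)
Definition weight S c : K :=
  (-1) ^+ size c *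
  (all (fun r => \bigcup_(J <- drop r c) J \in S) (iota 0 (size c)))%:R.

Lemma weight_cons S J c :
  weight S (J :: c) = - (\bigcup_(I <- J :: c) I \in S)%:R * weight S c.
Proof.
have iotaS : iota 1 (size c) = map succn (iota 0 (size c)) by exact: (iotaDl 1 0).
rewrite /weight /= iotaS all_map -mulnb natrM exprS mulN1r !mulNr.
by congr (- _); rewrite mulrCA.
Qed.

(** Only unions of non-empty suffixes are tested, and these are non-empty subsets of [W]. *)
Lemma eq_weight W S S' c : blocks_in W c ->
  (forall J, J != set0 -> J \subset W -> (J \in S) = (J \in S')) ->
  weight S c = weight S' c.
Proof.
move=> cW eqS; elim: c cW => [//|J c IHc] cW; rewrite !weight_cons.
rewrite eqS ?(bigcup_blocks_neq0 cW) ?bigcup_blocks_sub //.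
by rewrite IHc //; case/andP: cW.
Qed.

(** If exactly one of the two parts lies in [S], the branches cancel whether or not the union does;
    hence the hypothesis constrains unions only when both parts agree. *)
Lemma sum_weight_stuffle V W S a b :
    (forall I J, I != set0 -> I \subset V -> J != set0 -> J \subset W ->
      (I \in S) = (J \in S) -> (I :|: J \in S) = (I \in S)) ->
    blocks_in V a -> blocks_in W b ->
  \sum_(c <- stuffle a b) weight S c = weight S a * weight S b.
Proof.
move=> SU; elim: a b => [|I a IHa] b.
  by move=> _ _; rewrite big_seq1 [weight S [::]]mulr1 mul1r.
elim: b => [|J b IHb] aV bW.
  by rewrite stuffles0 big_seq1 [weight S [::]]mulr1 mulr1.
have /andP[_ aV'] := aV; have /andP[_ bW'] := bW.
rewrite stuffle_cons !big_cat !big_map.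
set U := \bigcup_(L <- I :: a) L :|: \bigcup_(L <- J :: b) L.
(* All terms of a stuffle have the same union, so the indicator of [U] factors out of each
   branch. *)
have sumE L a1 b1 : \bigcup_(M <- a1) M :|: \bigcup_(M <- b1) M :|: L = U ->
    \sum_(c <- stuffle a1 b1) weight S (L :: c) =
    - (U \in S)%:R * \sum_(c <- stuffle a1 b1) weight S c.
  move=> UE; rewrite mulr_sumr; apply: eq_big_seq => c /bigcup_stuffle cE.
  by rewrite weight_cons big_cons cE setUC UE.
rewrite (sumE I); last by rewrite /U !big_cons setUC setUA.
rewrite (sumE J); last by rewrite /U !big_cons setUC setUCA.
rewrite (sumE (I :|: J)); last by rewrite /U !big_cons setUC setUACA.
rewrite IHa // IHb // IHa // !weight_cons.
have := SU _ _ (bigcup_blocks_neq0 aV) (bigcup_blocks_sub aV)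
               (bigcup_blocks_neq0 bW) (bigcup_blocks_sub bW).
rewrite -/U.
(* With x, y, u the indicators of the two unions and of U, the claim reduces to
   - u (1 - x - y) = x y, and u = x whenever x = y. *)
case: (\bigcup_(L <- I :: a) L \in S); case: (\bigcup_(L <- J :: b) L \in S).
- by move=> /(_ erefl)-> /=; ring.
- by move=> _ /=; ring.
- by move=> _ /=; ring.
- by move=> /(_ erefl)-> /=; ring.
Qed.


(** The coefficient of a non-empty [c] in a cell element. The predecessor leaves the full union
    untested; on the empty sequence the value is 1. *)
Definition cut_weight S c : K := (-1) ^+ (size c).-1 *
  (all (fun r => \bigcup_(J <- take r c) J \in S) (iota 1 (size c).-1))%:R.

(** The block [J] carries no sign: the proper prefixes number [size d1 + size d2], one for each
    non-empty suffix of [d1] or [d2]. *)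
Lemma cut_weight_split W S d1 J d2 : is_proper_seq W (rev d1 ++ J :: d2) ->
  cut_weight (opposite W S) (rev d1 ++ J :: d2) =
  weight (opposite W S) d1 * weight S d2.
Proof.
set c := rev d1 ++ J :: d2 => cP.
have sc : (size c).-1 = (size d1 + size d2)%N.
  by rewrite size_cat size_rev addnS.
rewrite /cut_weight /weight sc exprD mulrACA -natrM mulnb; congr (_ * _%:R).
(* A prefix ending before J is a reversed suffix of d1; a prefix containing J
   lies in the opposite of S iff the remaining suffix of d2 lies in S. *)
have take1 r : (r <= size d1)%N ->
    \bigcup_(I <- take r c) I = \bigcup_(I <- drop (size d1 - r) d1) I.
  move=> rd; rewrite takel_cat ?size_rev // take_rev.
  exact/perm_big/permPl/perm_rev.
have take2 r : (\bigcup_(I <- take (1 + size d1 + r) c) I \in opposite W S) =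
    (\bigcup_(I <- drop r d2) I \in S).
  have -> : drop r d2 = drop (1 + size d1 + r) c.
    rewrite /c drop_cat size_rev ifN; last by lia.
    by rewrite (_ : (_ - _)%N = r.+1); last by lia.
  by apply: mem_opposite_cut; rewrite cat_take_drop.
rewrite iotaD all_cat; congr (nat_of_bool (_ && _)).
  (* The map [r] to [size d1 - r] exchanges prefix lengths [1 .. size d1] with drop lengths
     [0 .. size d1 - 1]. *)
  apply/allP/allP => H r; rewrite mem_iota => rd.
    have := H (size d1 - r)%N; rewrite mem_iota take1 ?leq_subr // subKn; last by lia.
    by apply; lia.
  by rewrite take1; [apply: H; rewrite mem_iota; lia | lia].
rewrite (_ : iota _ _ = [seq (1 + size d1 + r)%N | r <- iota 0 (size d2)]).
  by rewrite all_map; apply: eq_all => r; rewrite /= take2.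
by rewrite -iotaDl addn0.
Qed.

End Weight.

(** * Cutting a sequence at the block of a given point *)

Section CutAtPoint.
Variable o : T.

(** Covering gives a block containing [o], and disjointness keeps [o] out of the others. The initial
    part is recorded in reverse because [weight] reads suffixes. *)
Lemma proper_seq_cut W c : o \in W -> is_proper_seq W c ->
  exists d1 J d2, [/\ c = rev d1 ++ J :: d2, o \in J, J \subset W,
    blocks_in (W :\ o) d1 & blocks_in (W :\ o) d2].
Proof.
move=> oW cP; have cW := proper_seq_blocks cP.
have /and3P[_ dc /eqP uc] := cP.
have: has (fun J : {set T} => o \in J) c.
  apply/negPn/negP => /hasPn oc; move: oW; rewrite -uc; apply/negP.
  elim: c oc {cP cW dc uc} => [|J c IHc] oc; first by rewrite big_nil inE.
  rewrite big_cons inE negb_or oc ?mem_head //= IHc // => K Kc.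
  by rewrite oc // inE Kc orbT.
case/hasP=> J Jc oJ.
have [c1 [c2 Ec]] : exists c1 c2, c = c1 ++ J :: c2.
  by case/path.splitPr: Jc => c1 c2; exists c1, c2.
move: cW dc; rewrite Ec /blocks_in pairwise_cat all_cat /=.
case/and3P=> c1W /andP[_ JW] c2W /and3P[c1J _ /andP[Jc2 _]].
exists (rev c1), J, c2; split; rewrite ?revK ?blocks_in_rev //.
  apply/allP => K; rewrite mem_rev => Kc.
  have /andP[-> KW] := allP c1W _ Kc; rewrite subsetD1 KW /=.
  have := allrelP c1J _ _ Kc (mem_head _ _).
  by rewrite disjoint_sym => /disjointFr/(_ oJ)->.
apply/allP => K Kc; have /andP[-> KW] := allP c2W _ Kc; rewrite subsetD1 KW /=.
by have := allP Jc2 _ Kc; rewrite /= => /disjointFr/(_ oJ)->.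
Qed.

(** On both sides the distinguished block is the first to contain [o], so its position is forced. *)
Lemma cut_uniq c1 c2 d1 d2 J (K : {set T}) : o \in J -> o \in K ->
    all (fun I : {set T} => o \notin I) c1 -> all (fun I : {set T} => o \notin I) d1 ->
  c1 ++ J :: c2 = d1 ++ K :: d2 -> [/\ c1 = d1, J = K & c2 = d2].
Proof.
move=> oJ oK; elim: c1 d1 => [|I c1 IHc] [|L d1] //=.
- by move=> _ _ [-> ->].
- by move=> _ /andP[oL _] [JL]; rewrite -JL oJ in oL.
- by move=> /andP[oI _] _ [IK]; rewrite IK oK in oI.
by case/andP=> _ c1o /andP[_ d1o] [-> /(IHc _ c1o d1o)[-> -> ->]].
Qed.

End CutAtPoint.

(** * Sequences with prescribed restrictions to both sides *)

Section Glue.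
Variables (A B : {set T}) (o : T).
Hypotheses (dAB : [disjoint A & B]) (oA : o \notin A) (oB : o \notin B).
Let VA := A :|: [set o].
Let VB := B :|: [set o].
Variables (a1 a2 b1 b2 : seq {set T}) (Ja Jb : {set T}).
Hypotheses (a1A : blocks_in A a1) (a2A : blocks_in A a2).
Hypotheses (b1B : blocks_in B b1) (b2B : blocks_in B b2).
Hypotheses (oJa : o \in Ja) (oJb : o \in Jb).
Hypotheses (JaV : Ja \subset VA) (JbV : Jb \subset VB).

(** The fibre of restriction over a pair of cut sequences: the blocks through [o] merge, and the
    parts before and after them are stuffled independently. *)
Definition glued_seqs : seq (seq {set T}) :=
  [seq rev d1 ++ (Ja :|: Jb) :: d2 | d1 <- stuffle a1 b1, d2 <- stuffle a2 b2].

Let VAB : VA :\: VB = A.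
Proof.
apply/setP => x; rewrite !inE negb_or.
case: eqP => [->|_]; first by rewrite (negPf oA) andbF.
rewrite andbT orbF; case: (boolP (x \in A)) => [xA|]; last by rewrite andbF.
by rewrite (disjointFr dAB xA).
Qed.

Let VBA : VB :\: VA = B.
Proof.
apply/setP => x; rewrite !inE negb_or.
case: eqP => [->|_]; first by rewrite (negPf oB) andbF.
rewrite andbT orbF; case: (boolP (x \in B)) => [xB|]; last by rewrite andbF.
by rewrite (disjointFl dAB xB).
Qed.

Let VIo : VA :&: VB = [set o].
Proof. by rewrite -setUIl (disjoint_setI0 dAB) set0U. Qed.

Lemma notin_stuffle a b d : blocks_in A a -> blocks_in B b -> d \in stuffle a b ->
  all (fun I : {set T} => o \notin I) (rev d).
Proof.
move=> aA bB dab; apply/allP => I; rewrite mem_rev => /mem_bigcup_seq.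
rewrite (bigcup_stuffle dab) => /subsetP Id; apply/negP => /Id.
rewrite inE => /orP[]; apply/negP.
  by apply: contra oA; apply/subsetP/bigcup_blocks_sub.
by apply: contra oB; apply/subsetP/bigcup_blocks_sub.
Qed.

Lemma uniq_glued_seqs : uniq glued_seqs.
Proof.
apply: allpairs_uniq.
- by apply: (@uniq_stuffle VA VB); rewrite ?VAB ?VBA.
- by apply: (@uniq_stuffle VA VB); rewrite ?VAB ?VBA.
move=> _ _ /allpairsP[[d1 d2] [/= d1S _ ->]] /allpairsP[[e1 e2] [/= e1S _ ->]].
have d1o := notin_stuffle a1A b1B d1S; have e1o := notin_stuffle a1A b1B e1S.
have oJ : o \in Ja :|: Jb by rewrite inE oJa.
by case/(cut_uniq oJ oJ d1o e1o) => /(can_inj revK)-> _ ->.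
Qed.

(** Restriction commutes with cutting at [o]; [stuffle_restrict] and [restrict_stuffle] then give
    the two directions. *)
Lemma mem_glued_seqs c :
    is_proper_seq VA (rev a1 ++ Ja :: a2) -> is_proper_seq VB (rev b1 ++ Jb :: b2) ->
  (c \in glued_seqs) =
  [&& is_proper_seq (VA :|: VB) c, restrict_seq VA c == rev a1 ++ Ja :: a2 &
      restrict_seq VB c == rev b1 ++ Jb :: b2].
Proof.
move=> aP bP; apply/idP/idP.
  case/allpairsP=> -[d1 d2] [/= d1S d2S ->].
  move: a1A a2A b1B b2B; rewrite -{1 2}VAB -{1 2}VBA => a1V a2V b1V b2V.
  have [d1V d1a d1b] := stuffle_restrict a1V b1V d1S.
  have [d2V d2a d2b] := stuffle_restrict a2V b2V d2S.
  (* [Jb] meets [VA] at most in [o], which [Ja] already contains. *)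
  have JA : (Ja :|: Jb) :&: VA = Ja.
    rewrite setIUl (setIidPl JaV); apply/setUidPl.
    by rewrite (subset_trans (setSI VA JbV)) // setIC VIo sub1set.
  have JB : (Ja :|: Jb) :&: VB = Jb.
    rewrite setIUl (setIidPl JbV); apply/setUidPr.
    by rewrite (subset_trans (setSI VB JaV)) // VIo sub1set.
  have J0 (J : {set T}) : o \in J -> (J == set0) = false.
    by move=> oJ; apply/negbTE/set0Pn; exists o.
  have cA : restrict_seq VA (rev d1 ++ (Ja :|: Jb) :: d2) = rev a1 ++ Ja :: a2.
    by rewrite restrict_seq_cat restrict_seq_rev restrict_seq_cons JA J0 // d1a d2a.
  have cB : restrict_seq VB (rev d1 ++ (Ja :|: Jb) :: d2) = rev b1 ++ Jb :: b2.
    by rewrite restrict_seq_cat restrict_seq_rev restrict_seq_cons JB J0 // d1b d2b.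
  rewrite cA cB !eqxx !andbT; apply: is_proper_seq_glue; rewrite ?cA ?cB //.
  rewrite /blocks_in all_cat /= all_rev -!/(blocks_in _ _) d1V d2V setUSS // andbT.
  by rewrite setU_eq0 J0.
case/and3P=> cP /eqP cA /eqP cB.
have oV : o \in VA :|: VB by rewrite !inE eqxx !orbT.
have [d1 [J [d2 [cE oJ JV d1V d2V]]]] := proper_seq_cut oV cP.
(* Uniqueness of the cut identifies the restricted pieces of [c] with the given ones. *)
have cut V (e1 e2 : seq {set T}) (L : {set T}) : o \in V -> o \in L ->
    all (fun I : {set T} => o \notin I) (rev e1) ->
    restrict_seq V c = rev e1 ++ L :: e2 ->
    [/\ restrict_seq V d1 = e1, J :&: V = L & restrict_seq V d2 = e2].
  move=> oVV oL e1o; rewrite cE restrict_seq_cat restrict_seq_rev restrict_seq_cons.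
  have oJV : o \in J :&: V by rewrite inE oJ.
  rewrite ifN; last by apply/set0Pn; exists o.
  have d1o : all (fun I : {set T} => o \notin I) (rev (restrict_seq V d1)).
    apply/allP => I; rewrite mem_rev mem_filter => /andP[_ /mapP[K Kd ->]].
    have := allP d1V _ Kd; rewrite subsetD1 => /and3P[_ _].
    by apply: contra; rewrite inE => /andP[].
  by case/(cut_uniq oJV oL d1o e1o) => /(can_inj revK).
have blocks_notin (W : {set T}) (e : seq {set T}) : o \notin W -> blocks_in W e ->
    all (fun I : {set T} => o \notin I) (rev e).
  move=> oW eW; rewrite all_rev; apply: sub_all eW => I /andP[_ IW].
  by apply: contra oW; apply: subsetP.
have oVA : o \in VA by rewrite !inE eqxx orbT.
have oVB : o \in VB by rewrite !inE eqxx orbT.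
have [d1a JA d2a] := cut _ _ _ _ oVA oJa (blocks_notin _ _ oA a1A) cA.
have [d1b JB d2b] := cut _ _ _ _ oVB oJb (blocks_notin _ _ oB b1B) cB.
apply/allpairsP; exists (d1, d2); split=> /=.
- rewrite -d1a -d1b; apply: restrict_stuffle.
  by apply: blocks_in_sub d1V; apply: subsetDl.
- rewrite -d2a -d2b; apply: restrict_stuffle.
  by apply: blocks_in_sub d2V; apply: subsetDl.
- by rewrite cE -JA -JB -setIUr (setIidPl JV).
Qed.

End Glue.

(** * Disjoint unions in complementary paracells *)

Lemma cell_setU X S S' I J : paracell X S -> paracell X S' ->
    S :|: S' = proper_subsets X -> [disjoint S & S'] ->
    [disjoint I & J] -> I \in proper_subsets X -> J \in proper_subsets X ->
  (I \in S) = (J \in S) -> (I :|: J \in S) = (I \in S).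
Proof.
have setU_closed S0 : paracell X S0 -> [disjoint I & J] ->
    I \in S0 -> J \in S0 -> I :|: J \in S0.
  case/and3P=> /subsetP S0X _ /forall_inP S0U.
  rewrite -setI_eq0 => /eqP IJ0 IS JS.
  (* The intersection is empty, hence not a proper subset, so the paracell condition leaves only the
     union. *)
  have := forall_inP (S0U _ IS) _ JS; rewrite IJ0 => /orP[/S0X|//].
  by rewrite inE eqxx andbF.
move=> pS pS' SS' dSS' dIJ; rewrite -SS' !in_setU.
case: (boolP (I \in S)) => IS; case: (boolP (J \in S)) => // JS.
  by rewrite setU_closed.
(* Both sets lie in [S'], hence so does their union, which therefore misses [S]. *)
move=> /= IS' JS' _; apply/negbTE.
by rewrite (disjointFl dSS') // setU_closed.
Qed.

(** A set and its complement both in [S] would put [set0] or [X] in [S]. *)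
Lemma disjoint_opposite X S : paracell X S -> [disjoint S & opposite X S].
Proof.
case/and3P=> /subsetP SX _ /forall_inP SU; rewrite -setI_eq0.
apply/set0Pn => -[J /setIP[JS]]; rewrite inE => /andP[JX JS'].
have := forall_inP (SU _ JS) _ JS'.
rewrite setDE setICA setICr setI0 setUIr setUCr setIT (setUidPr JX).
by case/orP=> /SX; rewrite inE eqxx ?andbF.
Qed.

(** * Induced precells, seen on subsets of one side *)

Section Induced.
Variables (S S' : {set {set T}}) (A : {set T}) (o : T).
Hypothesis oA : o \notin A.

Lemma mem_induced_cell I : I != set0 -> I \subset A ->
  (I \in induced_cell S S' A o) = (I \in S).
Proof.
move=> I0 IA; have oI : o \notin I by apply: contra oA; apply: subsetP.
rewrite !inE I0 IA (negPf oI) orbF subsetU ?IA //=.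
by case: eqP oI => // ->; rewrite !inE eqxx orbT.
Qed.

(** The complement of [I] contains [o], so only the second clause of [induced_cell] can apply, and
    its complement in [A] is [I] again. *)
Lemma mem_opposite_induced_cell I : I != set0 -> I \subset A ->
  (I \in opposite (A :|: [set o]) (induced_cell S S' A o)) = (I \in S').
Proof.
move=> I0 IA; have oI : o \notin I by apply: contra oA; apply: subsetP.
have oAI : o \in (A :|: [set o]) :\: I by rewrite !inE oI eqxx orbT.
have AIA : A :\: ((A :|: [set o]) :\: I) = I.
  rewrite setDDr setDUr ?setDU; apply/setP => x; rewrite !inE.
  case: (boolP (x \in I)) => [xI|]; last by case: (x \in A).
  by rewrite (subsetP IA).
have AI0 : (A :|: [set o]) :\: I != set0 by apply/set0Pn; exists o.
have AIN : (A :|: [set o]) :\: I != A :|: [set o].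
  have [x xI] := set0Pn _ I0; apply/eqP => /setP/(_ x).
  by rewrite !inE xI (subsetP IA).
have NA : (A :|: [set o]) :\: I \subset A = false.
  by apply: contraNF oA => /subsetP/(_ o oAI).
by rewrite !inE subsetU ?IA //= subsetDl AI0 AIN NA AIA oI eqxx orbT.
Qed.

End Induced.


(** Only the term [nu = size c] contributes; it is in range because the size is positive and at most
    [#|W|]. *)
Lemma cell_eltE (R : realType) W S (c : proper_seq W) : (0 < size c)%N ->
  cell_elt R W S c = cut_weight (complex R) (opposite W S) c.
Proof.
move=> c0; rewrite /cell_elt sum_ffunE (bigD1_seq (size c)) ?iota_uniq //=; last first.
  by rewrite mem_index_iota c0 ltnS leq_size_proper_seq // ps_proper.
rewrite [X in _ + X]big1 => [|nu nuc]; last first.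
  by rewrite sum_free_basisE inE eq_sym (negPf nuc) mulr0.
rewrite sum_free_basisE addr0 subn1 /cut_weight; congr (_ * _%:R); rewrite inE eqxx /=.
congr nat_of_bool; apply/forallP/allP => H r.
  rewrite mem_iota => /andP[r1 rc]; have rc' : (r < size c)%N by lia.
  by have := H (Ordinal rc'); rewrite /= r1.
by apply/implyP => r1; apply: H; rewrite mem_iota r1 /=; have := ltn_ord r; lia.
Qed.

End SetSequences.

Theorem theorem3p1 (R : realType) (T : finType) (A B : {set T}) (o : T)
    (S S' : {set {set T}}) :
  [disjoint A & B] -> o \notin A -> o \notin B ->
  A != set0 -> B != set0 ->
  precell (A :|: B :|: [set o]) S ->
  precell (A :|: B :|: [set o]) S' ->
  S' = opposite (A :|: B :|: [set o]) S ->
  Fac (cell_elt R (A :|: B :|: [set o]) S) =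
    tensor (cell_elt R (A :|: [set o]) (induced_cell S S' A o))
           (cell_elt R (B :|: [set o]) (induced_cell S S' B o)).
Proof.
move=> dAB oA oB _ _ /andP[pS /eqP SS'] /andP[pS' _] S'E.
set X := A :|: B :|: [set o].
rewrite -S'E in SS'.
have dSS' : [disjoint S & S'] by rewrite S'E disjoint_opposite.
have properX (C D : {set T}) : o \notin D -> C \subset D -> D \subset X -> C != set0 ->
    C \in proper_subsets X.
  move=> oD CD DX C0; rewrite inE (subset_trans CD DX) C0 /=.
  apply: contraNneq oD => CX; apply: (subsetP CD).
  by rewrite CX !inE eqxx orbT.
have AX : A \subset X by rewrite /X -setUA subsetUl.
have BX : B \subset X by rewrite /X setUAC subsetUr.
(* Stated for a generic complementary pair, to serve [S'] before [o] and [S] after it. *)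
have SU (U U' : {set {set T}}) (HU : paracell X U) (HU' : paracell X U')
    (UU' : U :|: U' = proper_subsets X) (dU : [disjoint U & U']) (I J : {set T}) :
    I != set0 -> I \subset A -> J != set0 -> J \subset B ->
    (I \in U) = (J \in U) -> (I :|: J \in U) = (I \in U).
  move=> I0 IA J0 JB; apply: (cell_setU HU HU' UU' dU).
  - exact: disjointW IA JB dAB.
  - exact: properX oA IA AX I0.
  - exact: properX oB JB BX J0.
have SUS := SU _ _ pS pS' SS' dSS'.
have SUS' : forall I J : {set T},
    I != set0 -> I \subset A -> J != set0 -> J \subset B ->
    (I \in S') = (J \in S') -> (I :|: J \in S') = (I \in S').
  by apply: (SU _ _ pS' pS); rewrite ?[S' :|: S]setUC // disjoint_sym.
set VA := A :|: [set o]; set VB := B :|: [set o].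
have XE : X = VA :|: VB by rewrite /X /VA /VB setUACA setUid.
have VAo : VA :\ o = A by rewrite /VA setUC setU1K.
have VBo : VB :\ o = B by rewrite /VB setUC setU1K.
apply/ffunP => -[a b]; rewrite [RHS]ffunE /=.
have oVA : o \in VA by rewrite !inE eqxx orbT.
have oVB : o \in VB by rewrite !inE eqxx orbT.
have [a1 [Ja [a2 [aE oJa JaV]]]] := proper_seq_cut oVA (ps_proper a).
have [b1 [Jb [b2 [bE oJb JbV]]]] := proper_seq_cut oVB (ps_proper b).
rewrite VAo VBo => b1B b2B a1A a2A.
rewrite !cell_eltE ?aE ?bE ?size_cat ?addnS //.
have aP := ps_proper a; have bP := ps_proper b; rewrite aE in aP; rewrite bE in bP.
rewrite (cut_weight_split _ _ aP) (cut_weight_split _ _ bP).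
rewrite (eq_weight _ a1A (mem_opposite_induced_cell S S' oA)).
rewrite (eq_weight _ a2A (mem_induced_cell S S' oA)).
rewrite (eq_weight _ b1B (mem_opposite_induced_cell S S' oB)).
rewrite (eq_weight _ b2B (mem_induced_cell S S' oB)).
(* Regroup the four weights: [a1] with [b1] for [S'], and [a2] with [b2] for [S]. *)
rewrite mulrACA -(sum_weight_stuffle _ SUS' a1A b1B) -(sum_weight_stuffle _ SUS a2A b2B).
have memG c := mem_glued_seqs dAB oA oB a1A a2A b1B b2B oJa oJb JaV JbV c aP bP.
rewrite -/VA -/VB -XE in memG.
rewrite big_distrlr /=.
transitivity (\sum_(c <- glued_seqs a1 a2 b1 b2 Ja Jb) cut_weight R[i] S' c); last first.
  rewrite big_allpairs_dep /=; apply: eq_big_seq => d1 d1S; apply: eq_big_seq => d2 d2S.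
  rewrite S'E; apply: cut_weight_split.
  have : rev d1 ++ (Ja :|: Jb) :: d2 \in glued_seqs a1 a2 b1 b2 Ja Jb.
    by apply/allpairsP; exists (d1, d2).
  by rewrite memG => /and3P[].
(* The basis sequences that [Fac] sends to the basis vector at [(a, b)]. *)
pose P := [pred c : proper_seq X |
  (restrict_seq VA c == ps_seq a) && (restrict_seq VB c == ps_seq b)].
transitivity (\sum_(c in P) cell_elt R X S c).
  rewrite /Fac sum_ffunE [RHS]big_mkcond; apply: eq_bigr => c _.
  rewrite !ffunE /= inE -!val_eqE /= -/VA -/VB [_ == restrict_seq VA c]eq_sym.
  rewrite [_ == restrict_seq VB c]eq_sym -natrM mulnb.
  by case: ifP => _; [exact: mulr1 | exact: mulr0].
transitivity (\sum_(c in P) cut_weight R[i] S' c).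
  apply: eq_bigr => c /andP[/eqP ca _]; rewrite cell_eltE -?S'E //.
  (* [c] is non-empty because its restriction [a] has the block [Ja]. *)
  by case: (ps_seq c) ca => //; rewrite aE; case: (rev a1).
(* Both index lists are duplicate-free with the same members, so they agree up to permutation. *)
rewrite -big_enum -(big_map (@ps_seq T X) predT (cut_weight R[i] S')) /=.
apply: perm_big; apply: uniq_perm.
- by rewrite map_inj_uniq ?enum_uniq //; apply: val_inj.
- by apply: (uniq_glued_seqs dAB oA oB).
move=> c; rewrite memG; apply/mapP/and3P => [[d]|[cP ca cb]].
  rewrite mem_enum => /andP[da db] ->; rewrite -aE -bE; split=> //; exact: ps_proper.
by exists (ProperSeq cP); rewrite // mem_enum inE /= aE bE ca cb.
Qed.
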